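(* For every positive integer $n$ there exist matroids $M'$ and $N'$, neither of which has a coloop, such that: each of $M'$ and $N'$ is self-dual; both are positroids; both are transversal matroids; $M'$ and $N'$ have the same configuration; and $\kappa(N')-\kappa(M')\geq n$.
   Context: For a matroid $M$ with rank function $r$ and $X\subseteq E(M)$, write $\overline{X}=E(M)-X$ and $\lambda_M(X)=r(X)+r(\overline{X})-r(M)$. For $k\in\mathbb{N}$, a vertical $k$-separation of $M$ is a pair $(X,\overline{X})$ with $r(X)\geq k$, $r(\overline{X})\geq k$ and $\lambda_M(X)<k$. If $M$ has a vertical $k$-separation for some $k$ (equivalently, $E(M)$ is the union of two proper flats), the vertical connectivity $\kappa(M)$ is the least such $k$; otherwise $\kappa(M)=r(M)$. A cyclic flat of $M$ is a flat $F$ such that $M|F$ has no coloops; the cyclic flats form a lattice $\mathcal{Z}(M)$ under inclusion. The configuration of $M$ is the abstract lattice $\mathcal{Z}(M)$ together with the size and rank of the cyclic flat at each lattice element; two matroids have the same configuration if there is a lattice isomorphism between their lattices of cyclic flats preserving sizes and ranks. A matroid is self-dual if it is isomorphic to its dual. A positroid is a matroid of rank $r$ on $m$ elements represented over $\mathbb{R}$ by an $r\times m$ matrix all of whose $r\times r$ maximal minors are nonnegative. A matroid is transversal if it is a matroid union of rank-$1$ matroids. *)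

(* Defs.v *)
From mathcomp Require Import all_boot all_order all_algebra.
From mathcomp Require Import boolp reals.

Set Implicit Arguments.
Unset Strict Implicit.
Unset Printing Implicit Defensive.

Import Order.TTheory GRing.Theory Num.Theory.

Record matroid (E : finType) := Matroid {
  rk : {set E} -> nat;
  rk_card : forall X, rk X <= #|X|;
  rk_mono : forall X Y : {set E}, X \subset Y -> rk X <= rk Y;
  rk_submod : forall X Y : {set E}, rk (X :|: Y) + rk (X :&: Y) <= rk X + rk Y }.

Definition rank (E : finType) (M : matroid E) : nat := rk M [set: E].

Definition indep (E : finType) (M : matroid E) (X : {set E}) : bool :=
  rk M X == #|X|.

Definition basis (E : finType) (M : matroid E) (B : {set E}) : bool :=
  indep M B && (#|B| == rank M).

(* The rank function of the dual is r*(X) = |X| + r(E - X) - r(M); the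
   truncated subtraction is exact by [rank_le_cardC].  [basis_dual] below
   checks that its bases are the complements of the bases of M. *)
Definition dual_rk (E : finType) (M : matroid E) (X : {set E}) : nat :=
  #|X| + rk M (~: X) - rank M.

Section DualRestriction.
Variables (E : finType) (M : matroid E).

Lemma rkU_le (X Y : {set E}) : rk M (X :|: Y) <= #|X| + rk M Y.
Proof.
apply: leq_trans (leq_trans (rk_submod M X Y) _); first exact: leq_addr.
by rewrite leq_add2r rk_card.
Qed.

Lemma rank_le_cardC (X : {set E}) : rank M <= #|X| + rk M (~: X).
Proof. by rewrite /rank -(setUCr X) rkU_le. Qed.

Lemma dual_rk_card (X : {set E}) : dual_rk M X <= #|X|.
Proof. by rewrite leq_subLR addnC leq_add2r rk_mono ?subsetT. Qed.

Lemma dual_rk_mono (X Y : {set E}) :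
  X \subset Y -> dual_rk M X <= dual_rk M Y.
Proof.
move=> sXY; apply: leq_sub2r.
have -> : ~: X = (Y :\: X) :|: ~: Y.
  apply/setP=> x; rewrite !inE.
  by case xX: (x \in X); rewrite ?(subsetP sXY x xX) //= orbN.
apply: leq_trans (_ : #|X| + (#|Y :\: X| + rk M (~: Y)) <= _).
  by rewrite leq_add2l rkU_le.
by rewrite addnA -(cardsID X Y) (setIidPr sXY).
Qed.

Lemma dual_rk_submod (X Y : {set E}) :
  dual_rk M (X :|: Y) + dual_rk M (X :&: Y) <= dual_rk M X + dual_rk M Y.
Proof.
have addB a b : rank M <= a -> rank M <= b ->
    a - rank M + (b - rank M) = a + b - (rank M + rank M).
  by move=> ha hb; rewrite addnBA // addnBAC // subnDA.
rewrite /dual_rk !addB ?rank_le_cardC //; apply: leq_sub2r.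
rewrite addnACA cardsUI [leqRHS]addnACA leq_add2l setCU setCI addnC.
exact: rk_submod.
Qed.

Definition dual : matroid E :=
  Matroid dual_rk_card dual_rk_mono dual_rk_submod.

Lemma basis_dual (B : {set E}) : basis dual B = basis M (~: B).
Proof.
rewrite /basis /indep /rank /= /dual_rk setCT.
have rk0 : rk M set0 = 0.
  by apply/eqP; rewrite -leqn0 -(cards0 E) rk_card.
have rB := rank_le_cardC B; rewrite /rank in rB *.
have rT : rk M [set: E] <= #|[set: E]| := rk_card M _.
have rC : rk M (~: B) <= rk M [set: E] by rewrite rk_mono ?subsetT.
have cB : #|B| + #|~: B| = #|[set: E]| by rewrite cardsC cardsT.
rewrite rk0 addn0.
apply/andP/andP => -[/eqP h1 /eqP h2]; split; apply/eqP.
- have e : rk M (~: B) = rk M [set: E].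
    apply: (@addnI #|B|); rewrite -{2}h1 subnK //.
  rewrite e; apply: (@addnI #|B|); rewrite cB h2 subnK //.
- by apply: (@addnI #|B|); rewrite cB h2 subnK.
- by rewrite h1 h2 addnK.
- by rewrite -cB h2 addnK.
Qed.

(* M|F, as a matroid on the subtype of elements of F. *)
Variable F : {set E}.

Definition restrict_rk (X : {set {x : E | x \in F}}) : nat :=
  rk M (val @: X).

Lemma restrict_rk_card X : restrict_rk X <= #|X|.
Proof. by rewrite -(card_imset X val_inj) rk_card. Qed.

Lemma restrict_rk_mono (X Y : {set {x : E | x \in F}}) :
  X \subset Y -> restrict_rk X <= restrict_rk Y.
Proof. by move=> sXY; rewrite rk_mono ?imsetS. Qed.

Lemma restrict_rk_submod (X Y : {set {x : E | x \in F}}) :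
  restrict_rk (X :|: Y) + restrict_rk (X :&: Y)
    <= restrict_rk X + restrict_rk Y.
Proof.
rewrite /restrict_rk imsetU imsetI; last by move=> ? ? _ _; apply: val_inj.
exact: rk_submod.
Qed.

Definition restrict : matroid {x : E | x \in F} :=
  Matroid restrict_rk_card restrict_rk_mono restrict_rk_submod.

End DualRestriction.

Definition loop (E : finType) (M : matroid E) (e : E) : bool :=
  rk M [set e] == 0.

Definition coloop (E : finType) (M : matroid E) (e : E) : bool :=
  loop (dual M) e.

Definition coloopless (E : finType) (M : matroid E) : bool :=
  [forall e, ~~ coloop M e].

Definition isomorphic (E1 E2 : finType) (M1 : matroid E1) (M2 : matroid E2)
    : Prop :=
  exists2 f : E1 -> E2, bijective f &
    forall X : {set E1}, rk M2 (f @: X) = rk M1 X.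

Definition self_dual (E : finType) (M : matroid E) : Prop :=
  isomorphic M (dual M).

(* By submodularity the truncated subtraction is exact. *)
Definition lambda (E : finType) (M : matroid E) (X : {set E}) : nat :=
  rk M X + rk M (~: X) - rank M.

Definition vertical_separation (E : finType) (M : matroid E) (k : nat)
    (X : {set E}) : bool :=
  [&& k <= rk M X, k <= rk M (~: X) & lambda M X < k].

Definition has_vertical_separation (E : finType) (M : matroid E) (k : nat)
    : bool :=
  [exists X, vertical_separation M k X].

Definition kappa (E : finType) (M : matroid E) : nat :=
  if pselect (exists k, has_vertical_separation M k) is left sep
  then ex_minn sep else rank M.

Definition flat (E : finType) (M : matroid E) (F : {set E}) : bool :=
  [forall e, (e \notin F) ==> (rk M F < rk M (e |: F))].

Definition cyclic_flat (E : finType) (M : matroid E) (F : {set E}) : bool :=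
  flat M F && coloopless (restrict M F).

Definition cyclic_flats (E : finType) (M : matroid E) : {set {set E}} :=
  [set F | cyclic_flat M F].

(* The lattice Z(M) is ordered by inclusion, so a lattice isomorphism is a
   bijection preserving and reflecting inclusion; only the values of phi on
   cyclic flats matter. *)
Definition same_configuration (E1 E2 : finType)
    (M1 : matroid E1) (M2 : matroid E2) : Prop :=
  exists phi : {set E1} -> {set E2},
    [/\ {in cyclic_flats M1 &, injective phi},
        phi @: cyclic_flats M1 = cyclic_flats M2,
        {in cyclic_flats M1 &, forall F G,
           (phi F \subset phi G) = (F \subset G)},
        {in cyclic_flats M1, forall F, #|phi F| = #|F|} &
        {in cyclic_flats M1, forall F, rk M2 (phi F) = rk M1 F}].

Definition matroid_union (E : finType) (k : nat) (Ms : 'I_k -> matroid E)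
    (M : matroid E) : Prop :=
  forall X : {set E}, indep M X <->
    exists2 I : 'I_k -> {set E},
      forall i, indep (Ms i) (I i) & X = \bigcup_(i < k) I i.

Definition transversal_matroid (E : finType) (M : matroid E) : Prop :=
  exists k (Ms : 'I_k -> matroid E),
    (forall i, rank (Ms i) = 1) /\ matroid_union Ms M.

(* M is the vector matroid of A, the element e labelling column [pos e]. *)
Definition represents (R : fieldType) (E : finType) (r m : nat)
    (A : 'M[R]_(r, m)) (pos : E -> 'I_m) (M : matroid E) : Prop :=
  forall X : {set E},
    rk M X = \rank (colsub (fun i : 'I_#|X| => pos (enum_val i)) A).

(* The ground set carries no order of its own: M is a positroid when its
   elements can be arranged (by [pos]) as the columns of such a matrix. *)
Definition positroid (R : realType) (E : finType) (M : matroid E) : Prop :=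
  exists (A : 'M[R]_(rank M, #|E|)) (pos : E -> 'I_#|E|),
    [/\ bijective pos, represents A pos M &
        forall f : 'I_(rank M) -> 'I_#|E|,
          {homo f : i j / (i < j)%N} -> (0 <= \det (colsub f A))%R].

(* Main.v *)
Require Import Defs.
From mathcomp Require Import all_boot all_order all_algebra all_fingroup.
From mathcomp Require Import boolp reals zify lra.

(* Let |E| = 6n and let A, B be two 3n-subsets of E with |A :&: B| = c <= n.
   The rank function min(|X|, 3n, 2n + |X - A|, 2n + |X - B|) defines a matroid
   M_c of rank 3n whose cyclic flats are the empty set, A, B and E, so its
   configuration does not depend on c. For c = 0 the set A = E - B gives
   kappa <= n + 1, while in general kappa > n + c because the c elements
   outside A :|: B obstruct a separation along A and B; we take M' = M_0 and
   N' = M_n. With A and B intervals of a 6n-cycle, a half turn maps A and B to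
   their complements, and M_c is self-dual.

   M_c is the transversal matroid of 3n rows in three blocks P, S, Q of size n,
   where A - B meets P and S, A :&: B meets S, B - A meets S and Q, and
   D = E - (A :|: B) meets Q and P. It is represented by the matrix with
   entries x_j ^ (weight i j) on this pattern, where every x_j is huge compared
   with the previous ones. Expanding a minor along its last column, the sign is
   that of a single term of largest weight, and the block sizes make it
   positive. Conversely a nonzero minor yields a matching of columns with rows,
   so the minors are nonzero exactly on the bases of M_c. *)

Set Implicit Arguments.
Unset Strict Implicit.
Unset Printing Implicit Defensive.

Import Order.TTheory GRing.Theory Num.Theory.

(** * Minors with a dominant term *)

Section Minors.
Local Open Scope ring_scope.

Lemma det_neq0_perm (K : comNzRingType) k (A : 'M[K]_k) :
  \det A != 0 -> exists s : 'S_k, forall i, A i (s i) != 0.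
Proof.
move=> nz; suff /existsP[s /forallP h] : [exists s : 'S_k, [forall i, A i (s i) != 0]].
  by exists s.
apply: contraNT nz => /existsPn h; rewrite /determinant big1 // => s _.
have := h s; rewrite negb_forall => /existsP[i /negPn /eqP e].
by rewrite (bigD1 i) //= e mul0r mulr0.
Qed.

Definition minor (K : comNzRingType) (u : nat -> nat -> K) k (f g : nat -> nat) : K :=
  \det (\matrix_(i < k, j < k) u (f i) (g j)).

Lemma eq_minor (K : comNzRingType) (u u' : nat -> nat -> K) k f f' g g' :
    (forall p q, (p < k)%N -> (q < k)%N -> u (f p) (g q) = u' (f' p) (g' q)) ->
  minor u k f g = minor u' k f' g'.
Proof. by move=> h; congr (\det _); apply/matrixP=> i j; rewrite !mxE h. Qed.

Lemma minor_expand_last (K : comNzRingType) (u : nat -> nat -> K) k f g :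
  minor u k.+1 f g =
  \sum_(i < k.+1) u (f i) (g k) * ((-1) ^+ (i + k) * minor u k (f \o bump i) g).
Proof.
rewrite /minor (expand_det_col _ ord_max); apply: eq_bigr => i _.
rewrite mxE /cofactor; congr (_ * (_ * _)); congr (\det _).
by apply/matrixP=> p q; rewrite !mxE lift_max.
Qed.

(** A nonzero term of the determinant would match the first [t] columns injectively with the rows
    below [s], but [s < t]. *)
Lemma minor_zero_block (K : comNzRingType) (u : nat -> nat -> K) k f g s t :
    (s < t <= k)%N ->
    (forall p q, (s <= p < k)%N -> (q < t)%N -> u (f p) (g q) = 0) ->
  minor u k f g = 0.
Proof.
move=> /andP[st tk] z; apply/eqP; case: eqP => // /eqP /det_neq0_perm[r hr].
pose h (q : 'I_t) : 'I_k := (r^-1)%g (widen_ord tk q).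
have hs q : (h q < s)%N.
  rewrite ltnNge; apply: contraNN (hr (h q)) => sh.
  by rewrite mxE z ?sh ?ltn_ord // /h permKV /=.
have hi : injective (fun q => Ordinal (hs q)).
  move=> q q' /(congr1 val) /= e; apply: val_inj.
  by move: (perm_inj (val_inj e)) => /(congr1 val).
have := leq_card _ hi; rewrite !card_ord; lia.
Qed.

(** After multiplication by [y], every other term has size at most |b i| y^(e i0), because e i + 1
    <= e i0. The leading term wins once [y * b i0] exceeds the sum [c] of all |b i|. *)
Lemma dominant_sum_gt0 (F : realFieldType) k (i0 : 'I_k) (b : 'I_k -> F) (e : 'I_k -> nat) :
    0 < b i0 -> (forall i, i != i0 -> b i != 0 -> (e i < e i0)%N) ->
  exists X, forall y, X <= y -> 0 < \sum_i b i * y ^+ e i.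
Proof.
move=> b0 h; pose c := \sum_(i < k) `|b i|.
have c0 : 0 <= c by rewrite sumr_ge0.
exists (1 + c / b i0) => y hy.
have d0 : 0 <= c / b i0 by rewrite divr_ge0 // ltW.
have y1 : 1 <= y by lra.
have y0 : 0 < y by lra.
rewrite (bigD1 i0) //= -(pmulr_rgt0 _ y0) mulrDr.
have cy : c < y * b i0.
  by rewrite -ltr_pdivrMr //; lra.
have le1 : - (c * y ^+ e i0) <= y * \sum_(i < k | i != i0) b i * y ^+ e i.
  rewrite mulr_sumr /c (bigD1 i0) //= mulrDl opprD mulr_suml -sumrN.
  rewrite -[leRHS]add0r lerD //.
    by rewrite oppr_le0 mulr_ge0 // exprn_ge0 // ltW.
  apply: ler_sum => i ii0; have [->|bi] := eqVneq (b i) 0.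
    by rewrite normr0 !(mul0r, mulr0) oppr0.
  apply: (@le_trans _ _ (- (`|b i| * y ^+ (e i).+1))).
    by rewrite lerN2 ler_wpM2l // ler_weXn2l // h.
  rewrite mulrCA -exprS -mulNr ler_wpM2r ?exprn_ge0 ?(ltW y0) //.
  by rewrite lerNl -normrN ler_norm.
have : 0 < (y * b i0 - c) * y ^+ e i0 by rewrite mulr_gt0 ?exprn_gt0 // subr_gt0.
rewrite mulrBl => hp; rewrite mulrA; lra.
Qed.

Lemma eventually_forall_fin (F : realFieldType) (T : finType) (P : T -> F -> Prop) :
    (forall t, exists X, forall y, X <= y -> P t y) ->
  exists X, forall y, X <= y -> forall t, P t y.
Proof.
move=> h; have [X hX] := choice h.
exists (\sum_t `|X t|) => y hy t; apply: hX; apply: le_trans hy.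
by rewrite (bigD1 t) //= (le_trans (ler_norm _)) // lerDl sumr_ge0.
Qed.

End Minors.

Section Dominance.
Local Open Scope ring_scope.
Variables (F : realFieldType) (win : nat -> nat -> bool) (wt : nat -> nat -> nat).

Definition power_entry (x : nat -> F) i j : F :=
  if win i j then x j ^+ wt i j else 0.

(* [i0] carries the leading term of the minor with rows [f], columns [g], of
   size [k.+1], when it is expanded along its last column. *)
Definition dominated k (f g : nat -> nat) i0 :=
  forall i, (i <= k)%N -> i != i0 -> win (f i) (g k) ->
    (wt (f i) (g k) < wt (f i0) (g k))%N \/
    forall x, minor (power_entry x) k (f \o bump i) g = 0.

Variables (N : nat) (Phi : nat -> (nat -> nat) -> (nat -> nat) -> Prop).
Hypothesis Phi_bounded : forall k f g, Phi k f g ->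
  (k <= N)%N /\ forall p, (p < k)%N -> (f p <= N)%N /\ (g p <= N)%N.
(** Expansion along the last column stays within [Phi] on its leading term, and the cofactor sign
    there is positive because [i0 + k] is even. *)
Hypothesis Phi_step : forall k f g, Phi k.+1 f g ->
  (forall p, (p < k)%N -> (g p < g k)%N) /\
  exists i0 f', [/\ (i0 <= k)%N, forall p, (p < k)%N -> f (bump i0 p) = f' p,
    Phi k f' g, ~~ odd (i0 + k) & win (f i0) (g k) /\ dominated k f g i0].

(** The columns increase, so [x m] can occur only in the last one. The minor is then a combination
    of powers of [y] with signed cofactors as coefficients, and the leading cofactor is positive by
    [IH]. *)
Lemma eventually_minor_gt0 (x : nat -> F) m k f g :
    (forall k f g, Phi k f g -> (forall p, (p < k)%N -> (g p < m)%N) ->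
       0 < minor (power_entry x) k f g) ->
    Phi k f g -> (forall p, (p < k)%N -> (g p < m.+1)%N) ->
  exists X, forall y, X <= y ->
    0 < minor (power_entry (fun j => if j == m then y else x j)) k f g.
Proof.
move=> IH; case: k => [|k] Pk gm.
  by exists 0 => y _; rewrite /minor det_mx00.
have [ginc [i0 [f' [i0k ff' Pk' ev [w0 dom]]]]] := Phi_step Pk.
have upd y l h (glt : forall p, (p < l)%N -> (g p < m)%N) :
    minor (power_entry (fun j => if j == m then y else x j)) l h g =
    minor (power_entry x) l h g.
  apply: eq_minor => p q _ ql; rewrite /power_entry.
  by have := glt q ql; rewrite ltn_neqAle => /andP[/negPf->].
have gk := gm k (ltnSn k); rewrite ltnS leq_eqVlt in gk.
case/orP: gk => [/eqP gkm|gkm]; last first.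
  have glt p : (p < k.+1)%N -> (g p < m)%N.
    rewrite ltnS leq_eqVlt => /orP[/eqP->//|pk].
    exact: ltn_trans (ginc p pk) gkm.
  by exists 0 => y _; rewrite upd //; apply: IH.
have glt p : (p < k)%N -> (g p < m)%N by rewrite -gkm; apply: ginc.
pose cf i := (-1) ^+ (i + k) * minor (power_entry x) k (f \o bump i) g.
pose b (i : 'I_k.+1) := if win (f i) m then cf i else 0.
have i0k' : (i0 < k.+1)%N by [].
have b0 : 0 < b (Ordinal i0k').
  rewrite /b /= -gkm w0 /cf -signr_odd (negPf ev) expr0 mul1r.
  rewrite (@eq_minor _ _ (power_entry x) _ _ f' _ g); last first.
    by move=> p q pk _ /=; rewrite ff'.
  exact: IH.
have [i ii0 bi|X hX] := dominant_sum_gt0 (e := fun i => wt (f i) m) b0.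
  move: bi; rewrite /b; case: ifP => [wi|]; last by rewrite eqxx.
  rewrite -gkm in wi *; have ik : (i <= k)%N := ltn_ord i.
  have [//|z] := dom i ik ii0 wi.
  by rewrite /cf z mulr0 eqxx.
exists X => y /hX; rewrite minor_expand_last; congr (_ < _).
apply: eq_bigr => i _; rewrite upd // gkm /b /power_entry eqxx.
by case: ifP => _; rewrite ?mul0r // mulrC.
Qed.

Lemma dominant_minors_gt0 m : exists x : nat -> F,
  forall k f g, Phi k f g -> (forall p, (p < k)%N -> (g p < m)%N) ->
    0 < minor (power_entry x) k f g.
Proof.
elim: m => [|m [x IH]].
  exists (fun=> 0) => -[|k] f g _ h; first by rewrite /minor det_mx00.
  by have := h 0%N isT.
(* [Phi] takes functions on all of nat, but a minor reads only their values below [k <= N], each at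
   most [N]. The finitely many codes [t] share one threshold, and minors with the same code are
   equal. *)
pose T := ('I_N.+1 * {ffun 'I_N.+1 -> 'I_N.+1} * {ffun 'I_N.+1 -> 'I_N.+1})%type.
pose good (t : T) f g := [/\ Phi t.1.1 f g,
  forall p, (p < t.1.1)%N -> (g p < m.+1)%N,
  forall p, (p < t.1.1)%N -> f p = t.1.2 (inord p) &
  forall p, (p < t.1.1)%N -> g p = t.2 (inord p)].
have [t|X hX] := @eventually_forall_fin F T (fun t y => forall f g, good t f g ->
    0 < minor (power_entry (fun j => if j == m then y else x j)) t.1.1 f g).
  have [[f [g [Pf gm ft gt]]]|no] := pselect (exists f g, good t f g).
    have [X hX] := eventually_minor_gt0 IH Pf gm.
    exists X => y /hX; set v := power_entry _ => hy f' g' [_ _ ft' gt'].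
    by rewrite (@eq_minor _ _ v _ _ f _ g) // => p q pk qk; rewrite ft' // gt' // -ft // -gt.
  by exists 0 => y _ f g fg; case: no; exists f, g.
exists (fun j => if j == m then X else x j) => k f g Pk gm.
have [kN fgN] := Phi_bounded Pk.
have := hX X (lexx X) (inord k, [ffun p : 'I_N.+1 => inord (f p)],
  [ffun p : 'I_N.+1 => inord (g p)]) f g.
rewrite /= inordK // => -> //; split=> //=; rewrite inordK // => p pk;
  have [? ?] := fgN p pk; rewrite ffunE (inordK (_ : (p < N.+1)%N)) ?inordK //; lia.
Qed.

End Dominance.

(** * The sparsity pattern *)

Section Windows.
Variables (n c : nat).
Hypothesis cn : c <= n.

(* Rows P = [0, n), S = [n, 2n), Q = [2n, 3n); columns A = [0, 3n),
   B = [3n - c, 6n - c), D = [6n - c, 6n). *)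
Definition window i q :=
  [&& (q < 3 * n) ==> (i < 2 * n),
      (3 * n - c <= q < 6 * n - c) ==> (n <= i) &
      (6 * n - c <= q) ==> (i < n) || (2 * n <= i)].

(* In the columns of D, which follow B in cyclic order, the rows of P come after
   those of Q. *)
Definition weight i q := if (6 * n - c <= q) && (i < n) then i + 3 * n else i.

(* Enumerates the rows that remain once the last [j] rows of P are deleted. *)
Definition skip_rows j p := if p < n - j then p else p + j.

Definition diagonal_fit k j (g : nat -> nat) :=
  forall p, p < k -> g p < 6 * n - c /\ window (skip_rows j p) (g p).

(* [a], [b] and [d] count the columns left of B, in A, and outside D. In each
   step the last column of D takes the last remaining row of P, as long as
   enough rows of P and S are left for the columns in A (b + j < 2n), and then
   the last remaining row of Q. Passing to the next row of P crosses an even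
   number of rows only if no row of Q has been taken: this is the last clause. *)
Definition count_fit k j (g : nat -> nat) := exists a b d,
  [/\ [&& a <= b, b <= d & d <= k], forall p, p < k -> (p < a) = (g p < 3 * n - c),
      forall p, p < k -> (p < b) = (g p < 3 * n),
      forall p, p < k -> (p < d) = (g p < 6 * n - c) &
      [&& b + j <= 2 * n, n + d <= a + k + j, 2 * n <= d, b <= a + n &
          (k + j == 3 * n) || (b + j == 2 * n)]].

Definition fit k (f g : nat -> nat) := exists j,
  [/\ (j <= n) && (k + j <= 3 * n), forall p, p < k -> f p = skip_rows j p,
      forall p q, p < q < k -> g p < g q, forall p, p < k -> g p < 6 * n &
      diagonal_fit k j g \/ count_fit k j g].

Lemma fit_bounded k f g : fit k f g ->
  (k <= 6 * n) /\ forall p, p < k -> f p <= 6 * n /\ g p <= 6 * n.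
Proof.
case=> j [jk fE _ gb _]; split=> [|p pk]; first by lia.
have := gb p pk; rewrite fE // /skip_rows; case: ifP; lia.
Qed.

(** From position [a] on, [n <= a + j] puts the remaining rows past P, and the columns in A end
    before the rows of Q begin. *)
Lemma diagonal_fit_of_thresholds k j g a :
  k + j <= 3 * n -> n <= a + j ->
  (forall p, p < k -> (p < a) = (g p < 3 * n - c)) ->
  (forall p, p < k -> g p < 3 * n -> p + j < 2 * n) ->
  (forall p, p < k -> g p < 6 * n - c) -> diagonal_fit k j g.
Proof.
move=> kj naj ha hb hd p pk; split; first exact: hd.
have := ha p pk; have := hb p pk; have := hd p pk.
rewrite /window /skip_rows; case: ifP; lia.
Qed.

Lemma bumpE i p : bump i p = if i <= p then p.+1 else p.
Proof. by rewrite /bump; case: leqP. Qed.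

Lemma fit_step (F : realFieldType) k f g : fit k.+1 f g ->
  (forall p, p < k -> g p < g k) /\
  exists i0 f', [/\ i0 <= k, forall p, p < k -> f (bump i0 p) = f' p,
    fit k f' g, ~~ odd (i0 + k) & window (f i0) (g k) /\
      dominated F window weight k f g i0].
Proof.
case=> j [/andP[jn kj] fE ginc gb fitg]; split=> [p pk|].
  by apply: ginc; rewrite pk ltnSn.
have ginc' p q : p < q < k -> g p < g q by move=> h; apply: ginc; lia.
have gb' p : p < k -> g p < 6 * n by move=> h; apply: gb; lia.
have fE' p : p < k -> f p = skip_rows j p by move=> h; apply: fE; lia.
have fbump p : p < k -> f (bump k p) = f p by rewrite bumpE => pk; rewrite leqNgt pk.
(* Outside D the weights are the row indices, so the last row is the heaviest. *)
have diag : diagonal_fit k.+1 j g ->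
    exists i0 f', [/\ i0 <= k, forall p, p < k -> f (bump i0 p) = f' p,
    fit k f' g, ~~ odd (i0 + k) & window (f i0) (g k) /\
      dominated F window weight k f g i0].
  move=> dg; have [gk wk] := dg k (ltnSn k).
  exists k, f; split=> //.
  - exists j; split=> //; first by lia.
    by left=> p pk; apply: dg; lia.
  - by rewrite addnn odd_double.
  - split; first by rewrite fE.
    move=> i ik ik' _; left; rewrite /weight !fE // /skip_rows.
    by do ![case: ifP]; lia.
case: fitg => [//|[a [b [d [abd ha hb hd cnt]]]]].
have [dk|dk] := leqP k.+1 d.
  (* No column in D is left: [d = k.+1], and the count for B becomes [n <= a + j]. *)
  apply: diag; apply: (@diagonal_fit_of_thresholds _ _ _ a) => //; first by lia.
  - by move=> p pk; rewrite -hb //; lia.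
  - by move=> p pk; rewrite -hd //; lia.
have gkD : 6 * n - c <= g k by have := hd k (ltnSn k); lia.
have ha' p : p < k -> (p < a) = (g p < 3 * n - c) by move=> h; apply: ha; lia.
have hb' p : p < k -> (p < b) = (g p < 3 * n) by move=> h; apply: hb; lia.
have hd' p : p < k -> (p < d) = (g p < 6 * n - c) by move=> h; apply: hd; lia.
have [bj|bj] := ltnP (b + j) (2 * n).
  (* Here [k.+1 + j = 3 * n], and [2 * n <= d <= k] leaves a row of P. The last one is the heaviest,
     as [weight] lifts P above Q on D. *)
  exists (n - j).-1, (skip_rows j.+1).
  have i0k : (n - j).-1 < k.+1 by lia.
  split; first by lia.
  - move=> p pk; have := fE p.+1; have := fE p; rewrite bumpE /skip_rows.
    by case: (leqP (n - j).-1 p) => h1 e1 e2; [rewrite e2|rewrite e1]; do ?[case: ifP]; lia.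
  - exists j.+1; split=> //; first by lia.
    by right; exists a, b, d; split=> //; lia.
  (* The rows crossed are the [2 * n] rows of S and Q, all still present. *)
  - have -> : (n - j).-1 + k = (2 * n - j.+1).*2 by lia.
    by rewrite odd_double.
  - split; first by rewrite fE // /window /skip_rows; case: ifP; lia.
    move=> i ik ii0 _; left; rewrite /weight !fE // /skip_rows.
    by do ![case: ifP]; lia.
(* Now [b + j = 2 * n]: the remaining rows of P and S are as many as the columns in A, and the last
   row lies in Q. *)
exists k, f; split=> //.
- exists j; split=> //; first by lia.
  (* From [b <= a + n] follows [n <= a + j], which keeps the count for B valid with one row less. *)
  by right; exists a, b, d; split=> //; lia.
- by rewrite addnn odd_double.
- split; first by rewrite fE // /window /skip_rows; case: ifP; lia.
  move=> i ik ik' wi; have [nfi|fin] := leqP n (f i).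
    left; move: nfi; rewrite /weight !fE // /skip_rows.
    by do ![case: ifP]; lia.
  (* A row of P is heavier, but deleting it leaves only [b - 1] rows of P and S for the [b] columns
     in A, so its cofactor vanishes. *)
  right=> x; apply: (@minor_zero_block _ _ _ _ _ b.-1 b); first by lia.
  move=> p q pk qb; rewrite /power_entry; case: ifP => // /andP[/implyP h _].
  have : f (bump i p) < 2 * n by apply: h; rewrite -hb //; lia.
  move: fin; rewrite bumpE (fE i) //.
  have := fE p.+1; have := fE p; rewrite /skip_rows.
  by case: (leqP i p) => h1 e1 e2; [rewrite e2|rewrite e1]; do ?[case: ifP]; lia.
Qed.

Lemma exists_window_weights (F : realFieldType) : exists x : nat -> F,
  forall g, fit (3 * n) id g -> (0 < minor (power_entry window weight x) (3 * n) id g)%R.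
Proof.
have [x hx] := dominant_minors_gt0 fit_bounded (@fit_step F) (6 * n).
by exists x => g fg; apply: hx => //; case: fg => j [].
Qed.

End Windows.

(** * Matroids with two proper cyclic flats *)

Section MatroidFacts.
Variables (E : finType) (M : matroid E).

(** A maximal independent [J] between [I] and [X] gains no rank from any single element of [X]; by
    submodularity it gains none from all of them together. *)
Lemma indep_extend (I X : {set E}) : I \subset X -> indep M I ->
  exists J : {set E}, [/\ I \subset J, J \subset X, indep M J & #|J| = rk M X].
Proof.
move=> IX iI; pose P (J : {set E}) := [&& I \subset J, J \subset X & indep M J].
have PI : P I by rewrite /P subxx IX.
case: (arg_maxnP (fun J : {set E} => #|J|) PI) => J /and3P[IJ JX iJ] maxJ.
exists J; split=> //; apply/eqP; rewrite -(eqP iJ) eqn_leq rk_mono //=.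
have stuck e : e \in X -> rk M (e |: J) <= rk M J.
  move=> eX; have [eJ|eJ] := boolP (e \in J).
    by rewrite (setUidPr _) // sub1set.
  rewrite leqNgt (eqP iJ); apply/negP => lt.
  suff PeJ : P (e |: J) by have := maxJ _ PeJ; rewrite /= cardsU1 eJ ltnn.
  rewrite /P subsetU ?IJ ?orbT // subUset sub1set eX JX /indep /=.
  by rewrite eqn_leq rk_card cardsU1 eJ.
pose Q (Z : {set E}) := [&& J \subset Z, Z \subset X & rk M Z <= rk M J].
have QJ : Q J by rewrite /Q subxx JX leqnn.
case: (arg_maxnP (fun Z : {set E} => #|Z|) QJ) => Z /and3P[JZ ZX rZ] maxZ.
apply: (leq_trans _ rZ); rewrite rk_mono //; apply/subsetP => e eX.
apply: contraT => eZ.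
suff QeZ : Q (e |: Z) by have := maxZ _ QeZ; rewrite /= cardsU1 eZ ltnn.
rewrite /Q subsetU ?JZ ?orbT // subUset sub1set eX ZX /=.
have := rk_submod M (e |: J) Z; have := stuck e eX.
have -> : (e |: J) :|: Z = e |: Z by rewrite -setUA (setUidPr JZ).
have : rk M J <= rk M ((e |: J) :&: Z).
  by rewrite rk_mono // subsetI JZ subsetUr.
have := rk_mono M JZ; lia.
Qed.

Lemma coloopE e : coloop M e = (rk M (~: [set e]) < rank M).
Proof. by rewrite /coloop /loop /= /dual_rk cards1 subn_eq0 add1n. Qed.

Lemma coloopless_restrictP (F : {set E}) :
  reflect {in F, forall e, rk M F <= rk M (F :\ e)} (coloopless (restrict M F)).
Proof.
have imT : val @: [set: {x | x \in F}] = F.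
  apply/setP=> x; apply/imsetP/idP => [[[y yF] _ ->] //|xF].
  by exists (exist _ x xF).
have imC (e : {x | x \in F}) : val @: (~: [set e]) = F :\ val e.
  apply/setP=> x; rewrite in_setD1; apply/imsetP/andP => [[y + ->]|[xe xF]].
    by rewrite !inE => ye; split; [rewrite (inj_eq val_inj)|exact: valP].
  exists (exist _ x xF); last by [].
  by rewrite !inE -(inj_eq val_inj).
have colE e : ~~ coloop (restrict M F) e = (rk M F <= rk M (F :\ val e)).
  by rewrite /coloop /loop /= /dual_rk /rank /= /restrict_rk imT imC cards1 subn_eq0 add1n -leqNgt.
apply: (iffP forallP) => [h e eF|h e].
  by have := h (exist _ e eF); rewrite colE.
by rewrite colE; apply: h; apply: valP.
Qed.

End MatroidFacts.

Section TwoFlats.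
Variables (E : finType) (n : nat) (A B : {set E}).

(** The minimum of r(Z) + |X - Z| over the intended cyclic flats Z: the empty set, [E], [A] and [B],
    of ranks 0, 3n, 2n and 2n. *)
Definition two_flat_rk (X : {set E}) : nat :=
  minn (minn #|X| (3 * n)) (minn (2 * n + #|X :\: A|) (2 * n + #|X :\: B|)).

Lemma two_flat_rk_card X : two_flat_rk X <= #|X|.
Proof. rewrite /two_flat_rk; lia. Qed.

Lemma two_flat_rk_mono (X Y : {set E}) :
  X \subset Y -> two_flat_rk X <= two_flat_rk Y.
Proof.
move=> XY; have := subset_leq_card XY.
have := subset_leq_card (setSD A XY); have := subset_leq_card (setSD B XY).
rewrite /two_flat_rk; lia.
Qed.

Hypothesis cAB : #|A :&: B| <= n.

(** For each pair of terms attaining the minima on the right, some two terms on the left have no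
    larger sum. The critical pair is [A] with [B], where 3n and the size of [X :&: Y] serve, by
    [h5], [h6] and [cAB]. *)
Lemma two_flat_rk_submod (X Y : {set E}) :
  two_flat_rk (X :|: Y) + two_flat_rk (X :&: Y) <= two_flat_rk X + two_flat_rk Y.
Proof.
have modular Z : #|(X :|: Y) :\: Z| + #|(X :&: Y) :\: Z| = #|X :\: Z| + #|Y :\: Z|.
  by rewrite setDUl setDIl cardsUI.
have := modular set0; rewrite !setD0 => h0.
have hA := modular A; have hB := modular B.
have h1 Z : #|(X :&: Y) :\: Z| <= #|X :\: Z| by rewrite subset_leq_card // setSD // subsetIl.
have h2 Z : #|(X :&: Y) :\: Z| <= #|Y :\: Z| by rewrite subset_leq_card // setSD // subsetIr.
have h3 Z : #|(X :|: Y) :\: Z| + #|X :&: Y| <= #|X :\: Z| + #|Y|.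
  have := subset_leq_card (setSI Z (subsetIr X Y)).
  by have := modular Z; have := cardsID Z (X :&: Y); have := cardsID Z Y; lia.
have h4 Z : #|(X :|: Y) :\: Z| + #|X :&: Y| <= #|X| + #|Y :\: Z|.
  have := subset_leq_card (setSI Z (subsetIl X Y)).
  by have := modular Z; have := cardsID Z (X :&: Y); have := cardsID Z X; lia.
have h5 : #|X :&: Y| <= #|X :\: A| + #|Y :\: B| + #|A :&: B|.
  have h : X :&: Y \subset ((X :\: A) :|: (Y :\: B)) :|: (A :&: B).
    by apply/subsetP=> x; rewrite !inE; case: (x \in A); case: (x \in B); case: (x \in X); case: (x \in Y).
  apply: leq_trans (subset_leq_card h) _.
  by rewrite (leq_trans (leq_card_setU _ _)) // leq_add2r leq_card_setU.
have h6 : #|X :&: Y| <= #|X :\: B| + #|Y :\: A| + #|A :&: B|.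
  have h : X :&: Y \subset ((X :\: B) :|: (Y :\: A)) :|: (A :&: B).
    by apply/subsetP=> x; rewrite !inE; case: (x \in A); case: (x \in B); case: (x \in X); case: (x \in Y).
  apply: leq_trans (subset_leq_card h) _.
  by rewrite (leq_trans (leq_card_setU _ _)) // leq_add2r leq_card_setU.
have := (h1 set0, h2 set0, h1 A, h2 A, h1 B, h2 B, h3 A, h3 B, h4 A, h4 B).
rewrite !setD0 /two_flat_rk => -[[[[[[[[[]]]]]]]]]; lia.
Qed.

Definition two_flat_matroid : matroid E :=
  Matroid two_flat_rk_card two_flat_rk_mono two_flat_rk_submod.

Local Notation M := two_flat_matroid.

Lemma two_flat_indepE X :
  indep M X = [&& #|X| <= 3 * n, #|X :&: A| <= 2 * n & #|X :&: B| <= 2 * n].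
Proof.
have := (cardsID A X, cardsID B X); case; rewrite /indep /= /two_flat_rk; lia.
Qed.

Hypotheses (n0 : 0 < n) (cE : #|E| = 6 * n) (cA : #|A| = 3 * n) (cB : #|B| = 3 * n).

Let splitA (X : {set E}) := cardsID A X.
Let splitB (X : {set E}) := cardsID B X.

Lemma two_flat_rank : rank M = 3 * n.
Proof.
have := (cardsC A, cardsC B); rewrite /rank /= /two_flat_rk !setTD cardsT.
by rewrite cE cA cB => -[]; lia.
Qed.

Lemma two_flat_rkC1 e : rk M (~: [set e]) = 3 * n.
Proof.
have h0 := cardsC1 e; rewrite -setTD in h0.
have h1 := splitA (~: [set e]); have h2 := splitB (~: [set e]).
have h3 : #|~: [set e] :&: A| <= #|A| by rewrite subset_leq_card // subsetIr.
have h4 : #|~: [set e] :&: B| <= #|B| by rewrite subset_leq_card // subsetIr.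
move: h0 h1 h2 h3 h4; rewrite setTD cA cB cE /= /two_flat_rk; lia.
Qed.

Lemma two_flat_coloopless : coloopless M.
Proof. by apply/forallP => e; rewrite coloopE two_flat_rkC1 two_flat_rank ltnn. Qed.

(** In the dual rank of [f @: X] the terms of [A] and [B] become those of the rank of [X] by [meet],
    while the terms for size and full rank change places. *)
Lemma two_flat_self_dual (f : E -> E) :
  bijective f -> f @: A = ~: A -> f @: B = ~: B -> self_dual M.
Proof.
move=> bf fA fB; exists f => // X; have fi := bij_inj bf.
have meet (Z : {set E}) : f @: Z = ~: Z -> #|~: (f @: X) :\: Z| + #|X :&: Z| = #|~: Z|.
  move=> fZ; rewrite -(card_imset (X :&: Z) fi) imsetI; last by move=> ? ? _ _; apply: fi.
  by rewrite fZ -(cardsID (f @: X) (~: Z)) addnC setIC !setDE [_ :&: ~: Z]setIC.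
have mA := meet A fA; have mB := meet B fB.
have := (cardsC A, cardsC B, cardsC (f @: X), splitA X, splitB X, card_imset X fi).
rewrite /= /dual_rk two_flat_rank /= /two_flat_rk => -[[[[[]]]]].
rewrite cA cB cE; lia.
Qed.

(** Both sides of a vertical separation have rank below 3n. If one rank is attained at [A] and the
    other at [B], then [cov] gives lambda >= n + |E - (A :|: B)|, and this complement has as many
    elements as [A :&: B]. If a side has rank equal to its size, lambda is at least 2n. *)
Lemma two_flat_kappa_gt : n + #|A :&: B| < kappa M.
Proof.
rewrite /kappa; case: pselect => [sep|_]; last by rewrite two_flat_rank; lia.
case: ex_minnP => k /existsP[X /and3P[+ + +]] _.
have cov (Y : {set E}) : #|~: (A :|: B)| <= #|Y :\: A| + #|~: Y :\: B|.
  rewrite (leq_trans _ (leq_card_setU _ _)) // subset_leq_card //.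
  by apply/subsetP=> x; rewrite !inE; case: (x \in A); case: (x \in B); case: (x \in Y).
have := cov X; have := cov (~: X); rewrite setCK.
have := (cardsC (A :|: B), cardsUI A B, cardsC X, splitA X, splitB X).
have := (splitA (~: X), splitB (~: X), splitA setT, splitB setT).
have := (cardsUI (X :&: A) (~: X :&: A), cardsUI (X :&: B) (~: X :&: B)).
have part (Z : {set E}) : (X :&: Z) :|: (~: X :&: Z) = Z /\ #|(X :&: Z) :&: (~: X :&: Z)| = 0.
  split; first by rewrite -setIUl setUCr setTI.
  by rewrite setIACA setICr set0I cards0.
case: (part A) (part B) => -> -> [-> ->].
rewrite /lambda two_flat_rank /= /two_flat_rk !setTI cardsT cA cB cE.
move=> [? ?] [[[? ?] ?] ?] [[[[? ?] ?] ?] ?]; lia.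
Qed.

(** As [B] is the complement of [A], the set [A] separates with both ranks 2n and lambda equal to
    n. *)
Lemma two_flat_kappa_le : A :&: B = set0 -> kappa M <= n.+1.
Proof.
move=> AB0; have BCA : B = ~: A.
  apply/eqP; rewrite eqEcard; apply/andP; split.
    by rewrite -disjoints_subset -setI_eq0 setIC AB0.
  by have := cardsC A; rewrite cA cB cE; lia.
have sep : has_vertical_separation M n.+1.
  apply/existsP; exists A; rewrite /vertical_separation /lambda two_flat_rank /=.
  rewrite -BCA /two_flat_rk !setDv cards0.
  have := (splitA B, splitB A); rewrite setIC AB0 cards0 cA cB => -[]; lia.
rewrite /kappa; case: pselect => [s|[]]; last by exists n.+1.
by case: ex_minnP => k _; apply.
Qed.

(** A rank attained at [A] or [B] forces equality with that set ([full]): an element outside it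
    would be a coloop, and a flat misses none of its elements. A rank equal to the size makes every
    element a coloop, and a flat of rank 3n is everything. *)
Lemma two_flat_cyclic_flats :
  cyclic_flats M = [set set0; A; B; [set: E]].
Proof.
(* These keep the term of the other flat above 2n, so that a new element does raise the rank of [A]
   or [B]. *)
have cAB' : 0 < #|A :\: B| by have := splitB A; rewrite cA; lia.
have cBA' : 0 < #|B :\: A| by have := splitA B; rewrite setIC cB; lia.
have rA : rk M A = 2 * n by rewrite /= /two_flat_rk setDv cards0 cA; lia.
have rB : rk M B = 2 * n by rewrite /= /two_flat_rk setDv cards0 cB; lia.
have grow e (Z : {set E}) : e \notin Z -> 0 < #|(e |: Z) :\: Z|.
  by move=> eZ; rewrite card_gt0; apply/set0Pn; exists e; rewrite !inE eqxx eZ.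
have growD e (Z Y : {set E}) : #|Z :\: Y| <= #|(e |: Z) :\: Y|.
  by rewrite subset_leq_card // setSD // subsetUr.
have cut e (Z : {set E}) : e \in Z -> #|Z| = 3 * n -> 2 * n <= rk M (Z :\ e).
  by move=> eZ; have := cardsD1 e Z; rewrite eZ /= /two_flat_rk; lia.
apply/setP => F; rewrite !inE; apply/andP/idP => [[/forallP fl cyc]|].
  have {cyc} /coloopless_restrictP cyc := cyc.
  have fl' e : e \notin F -> rk M F < rk M (e |: F) by move=> eF; apply: (implyP (fl e)).
  have cut1 e (Y : {set E}) : e \in F -> e \notin Y -> #|(F :\ e) :\: Y| < #|F :\: Y|.
    move=> eF eY; rewrite (cardsD1 e (F :\: Y)) in_setD eY eF add1n ltnS.
    by rewrite subset_leq_card // !setDDl setUC.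
  have full (Z : {set E}) : rk M F = 2 * n + #|F :\: Z| -> (forall X, rk M X <= 2 * n + #|X :\: Z|) -> F = Z.
    move=> rF ub; have FZ : F \subset Z.
      apply/subsetP => e eF; apply: contraT => eZ.
      by have := cyc e eF; have := cut1 e Z eF eZ; have := ub (F :\ e); lia.
    apply/eqP; rewrite eqEsubset FZ; apply/subsetP => e eZ; apply: contraT => eF.
    have := fl' e eF; have := ub (e |: F); rewrite rF.
    suff /eqP -> : #|(e |: F) :\: Z| == 0 by lia.
    by rewrite cards_eq0 setD_eq0 subUset sub1set eZ.
  have [F0|[e eF]] := set_0Vmem F; first by rewrite F0 eqxx.
  have [|fA] := eqVneq (rk M F) (2 * n + #|F :\: A|).
    move=> /full ->; first by rewrite eqxx !orbT.
    by move=> X; rewrite /= /two_flat_rk; lia.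
  have [|fB] := eqVneq (rk M F) (2 * n + #|F :\: B|).
    move=> /full ->; first by rewrite eqxx !orbT.
    by move=> X; rewrite /= /two_flat_rk; lia.
  have [fc|fc] := eqVneq (rk M F) #|F|.
    have := cyc e eF; have := cardsD1 e F; rewrite eF.
    by have := rk_card M (F :\ e); lia.
  have rF : rk M F = 3 * n.
    by move: fA fB fc; rewrite /= /two_flat_rk; lia.
  suff -> : F = [set: E] by rewrite eqxx orbT.
  apply/setP => x; rewrite inE; apply: contraT => /fl'.
  by have := rk_mono M (subsetT (x |: F)); rewrite -/(rank M) two_flat_rank rF; lia.
move=> /orP[/orP[/orP[]|]|] /eqP ->; split.
- apply/forallP => e; apply/implyP => _; rewrite /= /two_flat_rk setU0 cards0 cards1; lia.
- by apply/coloopless_restrictP => e; rewrite inE.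
- apply/forallP => e; apply/implyP => eA; rewrite rA.
  have := (grow e A eA, growD e A B, cardsU1 e A).
  by rewrite /= eA cA /two_flat_rk => -[[]]; lia.
- by apply/coloopless_restrictP => e eA; rewrite rA cut.
- apply/forallP => e; apply/implyP => eB; rewrite rB.
  have := (grow e B eB, growD e B A, cardsU1 e B).
  by rewrite /= eB cB /two_flat_rk => -[[]]; lia.
- by apply/coloopless_restrictP => e eB; rewrite rB cut.
- by apply/forallP => e; rewrite inE.
- by apply/coloopless_restrictP => e _; rewrite -/(rank M) two_flat_rank setTD two_flat_rkC1.
Qed.

End TwoFlats.

(** Both lattices have two incomparable flats of size 3n and rank 2n between bottom and top, so
    exchanging [B1] for [B2] is an isomorphism. *)
Lemma two_flat_same_configuration (E : finType) n (A B1 B2 : {set E})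
    (c1 : #|A :&: B1| <= n) (c2 : #|A :&: B2| <= n) :
    0 < n -> #|E| = 6 * n -> #|A| = 3 * n -> #|B1| = 3 * n -> #|B2| = 3 * n ->
  same_configuration (two_flat_matroid c1) (two_flat_matroid c2).
Proof.
move=> n0 cE cA cB1 cB2.
have nsub (X Y : {set E}) : #|X :&: Y| < #|X| -> (X \subset Y) = false.
  by move=> h; apply/negP => /setIidPl e; rewrite e ltnn in h.
have sAB (B : {set E}) : #|A :&: B| <= n -> (A \subset B) = false.
  by move=> h; apply: nsub; rewrite cA; lia.
have sBA (B : {set E}) : #|A :&: B| <= n -> #|B| = 3 * n -> (B \subset A) = false.
  by move=> h cB; apply: nsub; rewrite setIC cB; lia.
have sZ0 (Z : {set E}) : #|Z| = 3 * n -> (Z \subset set0) = false.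
  by move=> cZ; apply: nsub; rewrite setI0 cards0 cZ; lia.
have sTZ (Z : {set E}) : #|Z| = 3 * n -> ([set: E] \subset Z) = false.
  by move=> cZ; apply: nsub; rewrite setTI cardsT cE cZ; lia.
have sT0 : ([set: E] \subset set0) = false.
  by apply: nsub; rewrite setI0 cards0 cardsT cE; lia.
have neq (X Y : {set E}) : (X \subset Y) = false -> (X == Y) = false.
  by move=> h; apply/eqP => e; rewrite e subxx in h.
have neq' (X Y : {set E}) : (X \subset Y) = false -> (Y == X) = false.
  by move=> h; rewrite eq_sym neq.
pose phi (X : {set E}) := if X == B1 then B2 else X.
have phi0 : phi set0 = set0 by rewrite /phi neq' ?sZ0.
have phiA : phi A = A by rewrite /phi neq ?sAB.
have phiB : phi B1 = B2 by rewrite /phi eqxx.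
have phiT : phi [set: E] = [set: E] by rewrite /phi neq ?sTZ.
have phiS : {in cyclic_flats (two_flat_matroid c1) &, forall F G,
    (phi F \subset phi G) = (F \subset G)}.
  move=> F G; rewrite two_flat_cyclic_flats // !inE.
  move=> /orP[/orP[/orP[]|]|] /eqP -> /orP[/orP[/orP[]|]|] /eqP ->;
    by rewrite ?phi0 ?phiA ?phiB ?phiT ?subxx ?sub0set ?subsetT ?sT0
      ?(sAB B1) ?(sAB B2) ?(sBA B1) ?(sBA B2) ?(sZ0 A) ?(sZ0 B1) ?(sZ0 B2)
      ?(sTZ A) ?(sTZ B1) ?(sTZ B2).
exists phi; split=> //.
- move=> F G FZ GZ e; apply/eqP; by rewrite eqEsubset -(phiS F G) // -(phiS G F) // e subxx.
- by rewrite !two_flat_cyclic_flats // !imsetU !imset_set1 phi0 phiA phiB phiT.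
- move=> F; rewrite two_flat_cyclic_flats // !inE.
  by move=> /orP[/orP[/orP[]|]|] /eqP ->; rewrite ?phi0 ?phiA ?phiB ?phiT // cB1 cB2.
- move=> F; rewrite two_flat_cyclic_flats // !inE.
  move=> /orP[/orP[/orP[]|]|] /eqP ->; rewrite ?phi0 ?phiA ?phiB ?phiT.
  + by rewrite /= /two_flat_rk !set0D cards0; lia.
  + by rewrite /= /two_flat_rk !setDv cards0 cA; lia.
  + by rewrite /= /two_flat_rk !setDv cards0 cB1 cB2; lia.
  + by rewrite -!/(rank _) !two_flat_rank.
Qed.

(** * Matroids of two intervals *)

Lemma card_ord_lt N b : b <= N -> #|[set i : 'I_N | i < b]| = b.
Proof.
move=> bN; rewrite -[RHS]card_ord -cardsT.
have wi : injective (widen_ord bN) by move=> i j /(congr1 val) /= e; apply: val_inj.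
rewrite -(card_imset _ wi).
apply: eq_card => i; rewrite !inE; apply/idP/imsetP => [ib|[j _ ->]]; last exact: ltn_ord j.
by exists (Ordinal ib) => //; apply: val_inj.
Qed.

Lemma card_ord_interval N a b : b <= N -> #|[set i : 'I_N | a <= i < b]| = b - a.
Proof.
move=> bN; have [ba|ab] := leqP b a.
  rewrite (_ : b - a = 0); last by lia.
  by apply: eq_card0 => i; rewrite !inE; lia.
have := cardsID [set i : 'I_N | i < a] [set i : 'I_N | i < b].
rewrite (card_ord_lt bN).
have -> : [set i : 'I_N | i < b] :&: [set i : 'I_N | i < a] = [set i : 'I_N | i < a].
  by apply/setP => i; rewrite !inE; lia.
have -> : [set i : 'I_N | i < b] :\: [set i : 'I_N | i < a] = [set i : 'I_N | a <= i < b].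
  by apply/setP => i; rewrite !inE; lia.
rewrite card_ord_lt; lia.
Qed.

(** This turns the number of chosen columns below a bound into the position thresholds [a], [b], [d]
    of [count_fit]. *)
Lemma downset_card k (S : {set 'I_k}) (p : 'I_k) :
  (forall q r : 'I_k, r \in S -> q < r -> q \in S) -> (p < #|S|) = (p \in S).
Proof.
move=> down; apply/idP/idP => [|pS].
  apply: contraTT => pS; rewrite -leqNgt -[leqRHS](card_ord_lt (ltnW (ltn_ord p))).
  apply: subset_leq_card; apply/subsetP => q qS; rewrite inE ltn_neqAle leqNgt.
  rewrite (contraNneq _ pS) => [|/val_inj <- //] /=.
  by apply: contraNN pS; apply: down.
rewrite -[p.+1](card_ord_lt (ltn_ord p)); apply: subset_leq_card.
apply/subsetP => q; rewrite inE ltnS leq_eqVlt => /orP[/eqP/val_inj-> //|].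
exact: down.
Qed.

Lemma enum_val_ltn N (X : {set 'I_N}) (i j : 'I_#|X|) :
  i < j -> enum_val i < enum_val j.
Proof.
move=> ij; pose x0 := enum_val i; rewrite !(enum_val_nth x0).
have tr : transitive (relpre (@nat_of_ord N) ltn) by move=> ? ? ?; apply: ltn_trans.
have srt : sorted (relpre (@nat_of_ord N) ltn) (enum X).
  rewrite /enum_mem -enumT; apply: sorted_filter => //.
  by rewrite -sorted_map val_enum_ord iota_ltn_sorted.
by apply: (sorted_ltn_nth tr x0 srt) => //; rewrite inE -cardE ltn_ord.
Qed.

(** Minors take their columns from functions on nat; the default 0 is never read by a minor of size
    [k]. *)
Definition ord_fun_ext k N (g : 'I_k -> 'I_N) (p : nat) : nat :=
  if insub p is Some i then val (g i) else 0.

Lemma ord_fun_extE k N (g : 'I_k -> 'I_N) (p : 'I_k) : ord_fun_ext g p = g p.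
Proof. by rewrite /ord_fun_ext (valK p). Qed.

Section Concrete.
Variables (n c : nat).
Definition flatA : {set 'I_(6 * n)} := [set i : 'I_(6 * n) | i < 3 * n].

Lemma card_flatA : #|flatA| = 3 * n.
Proof. by rewrite card_ord_lt //; lia. Qed.

Hypothesis cn : c <= n.

Definition flatB : {set 'I_(6 * n)} := [set i : 'I_(6 * n) | 3 * n - c <= i < 6 * n - c].

Lemma card_flatB : #|flatB| = 3 * n.
Proof. by rewrite card_ord_interval; lia. Qed.

Lemma card_flatAB : #|flatA :&: flatB| = c.
Proof.
have -> : flatA :&: flatB = [set i : 'I_(6 * n) | 3 * n - c <= i < 3 * n].
  by apply/setP => i; rewrite !inE; lia.
rewrite card_ord_interval; lia.
Qed.

Lemma card_flatAB_le : #|flatA :&: flatB| <= n.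
Proof. by rewrite card_flatAB. Qed.

Definition interval_matroid := two_flat_matroid card_flatAB_le.
Local Notation M := interval_matroid.

Hypothesis n0 : 0 < n.

Lemma half_turn_subproof (i : 'I_(6 * n)) :
  (if i < 3 * n then i + 3 * n else i - 3 * n) < 6 * n.
Proof. by have := ltn_ord i; case: ifP; lia. Qed.

Definition half_turn i := Ordinal (half_turn_subproof i).

Lemma half_turnK : involutive half_turn.
Proof.
move=> i; apply: val_inj => /=; have := ltn_ord i.
by do ![case: ifP]; lia.
Qed.

Lemma interval_matroid_self_dual : self_dual M.
Proof.
have pre := can2_imset_pre _ half_turnK half_turnK.
have fA : half_turn @: flatA = ~: flatA.
  rewrite pre; apply/setP => i; rewrite !inE /=.
  by have := ltn_ord i; case: ifP; lia.
have fB : half_turn @: flatB = ~: flatB.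
  rewrite pre; apply/setP => i; rewrite !inE /=.
  by have := ltn_ord i; case: ifP; lia.
apply: two_flat_self_dual (inv_bij half_turnK) fA fB => //.
- by rewrite card_ord.
- exact: card_flatA.
- exact: card_flatB.
Qed.

(** All rows are present, so [j = 0]. The two count hypotheses give b <= 2n and d - a <= 2n; the
    sizes of D and of the intersection of A and B, both c <= n, give 2n <= d and b <= a + n. *)
Lemma fit_of_counts (g : 'I_(3 * n) -> 'I_(6 * n)) :
    {homo g : i j / i < j} ->
    #|[set p | g p \in flatA]| <= 2 * n -> #|[set p | g p \in flatB]| <= 2 * n ->
  fit n c (3 * n) id (ord_fun_ext g).
Proof.
move=> ginc cA cB.
have gE := ord_fun_extE g.
have ginj : injective g.
  move=> i j; have [/ginc + e|/ginc + e|/val_inj //] := ltngtP i j; by rewrite e ltnn.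
pose S t := [set p | g p < t].
have Sdown t (p : 'I_(3 * n)) : (p < #|S t|) = (ord_fun_ext g p < t).
  rewrite downset_card ?gE ?inE // => q r; rewrite !inE => rt /ginc qr.
  exact: ltn_trans qr rt.
have Sdiff a b : a <= b -> #|S b| = #|S a| + #|[set p | a <= g p < b]|.
  move=> ab; rewrite -(cardsID (S a) (S b)); congr (_ + _); apply: eq_card => p; rewrite !inE; lia.
have gcard a b : b <= 6 * n -> #|[set p | a <= g p < b]| <= b - a.
  move=> bn; rewrite -(card_ord_interval a bn) -(card_imset _ ginj) subset_leq_card //.
  by apply/subsetP => q /imsetP[p + ->]; rewrite !inE.
exists 0; split; first by lia.
- by move=> p _; rewrite /skip_rows addn0; case: ifP.
- move=> p q /andP[pq qk]; have pk := ltn_trans pq qk.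
  by rewrite (gE (Ordinal pk)) (gE (Ordinal qk)); apply: ginc.
- by move=> p pk; rewrite (gE (Ordinal pk)).
right; exists #|S (3 * n - c)|, #|S (3 * n)|, #|S (6 * n - c)|.
have Stop : #|S (6 * n)| = 3 * n.
  rewrite -[RHS]card_ord -cardsT; apply: eq_card => p; rewrite !inE; exact: ltn_ord.
have d1 : 3 * n - c <= 3 * n by lia.
have d2 : 3 * n <= 6 * n - c by lia.
have d3 : 6 * n - c <= 6 * n by lia.
have d4 : 3 * n - c <= 6 * n - c by lia.
have d5 : 3 * n <= 6 * n by lia.
have := (Sdiff _ _ d1, Sdiff _ _ d2, Sdiff _ _ d3, Sdiff _ _ d4).
have := (gcard (3 * n - c) _ d5, gcard (6 * n - c) _ (leqnn _)).
have eA : #|[set p | g p \in flatA]| = #|S (3 * n)|.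
  by apply: eq_card => p; rewrite !inE.
have eB : #|[set p | g p \in flatB]| = #|[set p | 3 * n - c <= g p < 6 * n - c]|.
  by apply: eq_card => p; rewrite !inE.
rewrite Stop => -[i1 i2] [[[e1 e2] e3] e4]; split; try by move=> p pk; apply: (Sdown _ (Ordinal pk)).
- by lia.
- by lia.
Qed.

(** * The representing matrix *)

Local Open Scope ring_scope.
Variables (F : realFieldType) (x : nat -> F).
Hypothesis hx : forall g, fit n c (3 * n) id g ->
  0 < minor (power_entry (window n c) (weight n c) x) (3 * n) id g.

Definition window_mx : 'M[F]_(3 * n, 6 * n) :=
  \matrix_(i, j) power_entry (window n c) (weight n c) x i j.

Lemma det_window_mx_gt0 (g : 'I_(3 * n) -> 'I_(6 * n)) :
    {homo g : i j / (i < j)%N} ->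
    (#|[set p | g p \in flatA]| <= 2 * n)%N -> (#|[set p | g p \in flatB]| <= 2 * n)%N ->
  0 < \det (colsub g window_mx).
Proof.
move=> ginc cA cB; have := hx (fit_of_counts ginc cA cB).
by congr (_ < \det _); apply/matrixP => i j; rewrite !mxE ord_fun_extE.
Qed.

Lemma window_mx_matching k (f : 'I_k -> 'I_(3 * n)) (g : 'I_k -> 'I_(6 * n)) :
    \det (mxsub f g window_mx) != 0 ->
  exists s : 'S_k, forall i, window n c (f i) (g (s i)).
Proof.
move=> /det_neq0_perm[s hs]; exists s => i; have := hs i.
by rewrite !mxE /power_entry; case: ifP => //; rewrite eqxx.
Qed.

(** A nonzero minor matches columns with distinct rows; columns in A admit only the 2n rows of P and
    S, columns in B only those of S and Q. *)
Lemma window_mx_counts k (f : 'I_k -> 'I_(3 * n)) (g : 'I_k -> 'I_(6 * n)) :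
    injective f -> \det (mxsub f g window_mx) != 0 ->
  ((#|[set p | g p \in flatA]| <= 2 * n) && (#|[set p | g p \in flatB]| <= 2 * n))%N.
Proof.
move=> fi /window_mx_matching[s hs].
pose h p := f ((s^-1)%g p).
have hi : injective h by move=> p q /fi /perm_inj.
have hw p : window n c (h p) (g p) by have := hs ((s^-1)%g p); rewrite permKV.
apply/andP; split.
- have bn : (2 * n <= 3 * n)%N by lia.
  rewrite -[leqRHS](card_ord_lt bn) -(card_imset _ hi) subset_leq_card //.
  apply/subsetP => q /imsetP[p + ->]; rewrite !inE.
  by have := hw p; rewrite /window; lia.
- have -> : (2 * n = 3 * n - n)%N by lia.
  rewrite -(card_ord_interval n (leqnn (3 * n))) -(card_imset _ hi) subset_leq_card //.
  apply/subsetP => q /imsetP[p + ->]; rewrite !inE ltn_ord.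
  by have := hw p; rewrite /window; lia.
Qed.

Lemma interval_matroid_indepE X : indep M X =
  [&& #|X| <= 3 * n, #|X :&: flatA| <= 2 * n & #|X :&: flatB| <= 2 * n]%N.
Proof. exact: two_flat_indepE. Qed.

Lemma interval_matroid_rank : rank M = (3 * n)%N.
Proof. by apply: two_flat_rank; rewrite ?card_ord ?card_flatA ?card_flatB. Qed.

Lemma card_preim_inj (T U : finType) (g : T -> U) (Y : {set U}) :
  injective g -> #|[set p | g p \in Y]| = #|(g @: [set: T]) :&: Y|.
Proof.
move=> gi; rewrite -(card_imset _ gi); apply: eq_card => y; rewrite inE.
apply/imsetP/andP => [[p + ->]|[/imsetP[p _ ->] pY]].
  by rewrite inE => pY; rewrite imset_f.
by exists p; rewrite ?inE.
Qed.

Lemma indep_window_mx (I : {set 'I_(6 * n)}) : indep M I ->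
  exists2 g : 'I_(3 * n) -> 'I_(6 * n),
    I \subset g @: [set: 'I_(3 * n)] & \det (colsub g window_mx) != 0.
Proof.
move=> iI; have [J [IJ _ iJ]] := indep_extend (subsetT I) iI.
rewrite -/(rank M) interval_matroid_rank => cJ.
pose g p := enum_val (cast_ord (esym cJ) p).
have gi : injective g by move=> p q /enum_val_inj /cast_ord_inj.
have gJ : g @: [set: 'I_(3 * n)] = J.
  apply/eqP; rewrite eqEcard card_imset // cardsT card_ord cJ leqnn andbT.
  by apply/subsetP => q /imsetP[p _ ->]; apply: enum_valP.
exists g; first by rewrite gJ.
have := iJ; rewrite interval_matroid_indepE -gJ -!card_preim_inj // => /and3P[_ cA cB].
rewrite gt_eqF // det_window_mx_gt0 // => p q pq.
exact: enum_val_ltn.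
Qed.

Lemma window_mx_represents : represents window_mx id M.
Proof.
move=> X; set C := colsub _ _; apply/eqP; rewrite eqn_leq; apply/andP; split.
(* A maximal independent subset [I] of [X] lies in a basis, whose columns form an invertible
   matrix. *)
- have [|I [_ IX iI <-]] := @indep_extend _ M set0 X (sub0set _).
    by rewrite interval_matroid_indepE !set0I cards0.
  have [g Ig dg] := indep_window_mx iI.
  have gP (i : 'I_#|I|) : exists p, g p == enum_val i.
    by have /imsetP[p _ ->] := subsetP Ig _ (enum_valP i); exists p.
  pose h i := xchoose (gP i).
  have hE i : g (h i) = enum_val i by apply/eqP; apply: (xchooseP (gP i)).
  have hi : injective h by move=> i j e; apply: enum_val_inj; rewrite -!hE e.
  pose D := rowsub (fun i : 'I_#|I| => enum_val i) window_mx^T.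
  have DE : D = rowsub h 1%:M *m (colsub g window_mx)^T.
    rewrite -rowsubE; apply/matrixP => i j; rewrite !mxE hE //.
  have rD : \rank D = #|I|.
    rewrite DE mxrankMfree; last by rewrite row_free_unit unitmx_tr unitmxE unitfE.
    apply/eqP; rewrite eqn_leq rank_leq_row -[leqLHS](mxrank1 F).
    (* The selection matrix has a right inverse because [h] is injective. *)
    suff {1}<- : rowsub h 1%:M *m colsub h 1%:M = 1%:M :> 'M[F]__ by exact: mxrankM_maxl.
    by rewrite -rowsubE; apply/matrixP => i j; rewrite !mxE (inj_eq hi).
  rewrite -rD -[leqRHS]mxrank_tr; apply: mxrankS.
  pose v (i : 'I_#|I|) := enum_rank_in (subsetP IX _ (enum_valP i)) (enum_val i).
  have -> : C^T = rowsub (fun i : 'I_#|X| => enum_val i) window_mx^T.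
    by apply/matrixP => i j; rewrite !mxE.
  apply: (submx_rowsub v) => i /=; rewrite enum_rankK_in //.
  exact: subsetP IX _ (enum_valP i).
(* Conversely, a maximal set of linearly independent columns in [X] carries a nonzero square minor,
   so the counts make it independent in [M]. *)
- rewrite -mxrank_tr; set r := \rank _.
  pose mf := maxrankfun C^T.
  pose g i := enum_val (mf i).
  have gi : injective g by move=> i j /enum_val_inj /maxrankfun_inj.
  pose G := colsub g window_mx.
  have GE : G = (rowsub mf C^T)^T by apply/matrixP => i j; rewrite !mxE.
  have fG : row_full G by rewrite GE /row_full mxrank_tr; apply: maxrowsub_free.
  have dG := fullrowsub_unit fG.
  have := @window_mx_counts _ (fullrankfun fG) g (@fullrankfun_inj _ _ _ _ fG).
  have -> : mxsub (fullrankfun fG) g window_mx = rowsub (fullrankfun fG) G.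
    by apply/matrixP => i j; rewrite !mxE.
  rewrite -unitfE -unitmxE => /(_ dG); rewrite !card_preim_inj // => /andP[cA cB].
  have cY : #|g @: [set: 'I_r]| = r by rewrite card_imset // cardsT card_ord.
  have /eqP : indep M (g @: [set: 'I_r]).
    by rewrite interval_matroid_indepE cA cB cY /r mxrank_tr rank_leq_row.
  rewrite cY => rY; apply: leq_trans (eq_leq (esym rY)) _.
  by apply: rk_mono; apply/subsetP => q /imsetP[i _ ->]; apply: enum_valP.
Qed.

Lemma det_window_mx_ge0 (g : 'I_(3 * n) -> 'I_(6 * n)) :
  {homo g : i j / (i < j)%N} -> 0 <= \det (colsub g window_mx).
Proof.
move=> ginc; have [->//|nz] := eqVneq (\det (colsub g window_mx)) 0.
have /andP[cA cB] := @window_mx_counts _ id g (@inj_id _) nz.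
exact/ltW/det_window_mx_gt0.
Qed.

End Concrete.

(** * Rank-one matroids *)

Section RankOne.
Variables (E : finType) (W : {set E}).

Definition rank_one_rk (X : {set E}) : nat := X :&: W != set0.

Lemma rank_one_rk_card X : rank_one_rk X <= #|X|.
Proof.
rewrite /rank_one_rk; case: set0Pn => // -[x]; rewrite inE => /andP[xX _].
by rewrite card_gt0; apply/set0Pn; exists x.
Qed.

Lemma rank_one_rk_mono (X Y : {set E}) :
  X \subset Y -> rank_one_rk X <= rank_one_rk Y.
Proof.
move=> XY; rewrite /rank_one_rk; have [//|/set0Pn[x]] := eqVneq (X :&: W) set0.
rewrite inE => /andP[xX xW]; suff -> : Y :&: W != set0 by [].
by apply/set0Pn; exists x; rewrite inE xW (subsetP XY).
Qed.

Lemma rank_one_rk_submod (X Y : {set E}) :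
  rank_one_rk (X :|: Y) + rank_one_rk (X :&: Y) <= rank_one_rk X + rank_one_rk Y.
Proof.
have := rank_one_rk_mono (subsetIl X Y); have := rank_one_rk_mono (subsetIr X Y).
rewrite /rank_one_rk setIUl setU_eq0; do 3![case: eqVneq => _] => //.
Qed.

Definition rank_one_matroid : matroid E :=
  Matroid rank_one_rk_card rank_one_rk_mono rank_one_rk_submod.

Lemma rank_one_rank : W != set0 -> rank rank_one_matroid = 1.
Proof. by rewrite /rank /= /rank_one_rk setTI => ->. Qed.

Lemma rank_one_indep X : indep rank_one_matroid X = (#|X| <= 1) && (X \subset W).
Proof.
rewrite /indep /= /rank_one_rk.
have [->|] := set_0Vmem X; first by rewrite set0I eqxx cards0 sub0set.
case=> x xX; have X0 : 0 < #|X| by rewrite card_gt0; apply/set0Pn; exists x.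
have [X1|X1] := leqP #|X| 1; last by case: (X :&: W != set0) => /=; lia.
have /cards1P[y Xy] : #|X| == 1 by lia.
rewrite Xy cards1 sub1set /=; case: set0Pn => [[z]|h].
  by rewrite !inE => /andP[/eqP-> ->].
by apply/esym/negP => yW; apply: h; exists y; rewrite !inE eqxx.
Qed.

End RankOne.

Lemma card_le_bigcup_small (E I : finType) (P : pred I) (F : I -> {set E}) (X : {set E}) :
    (forall i, #|F i| <= 1) -> X \subset \bigcup_(i | P i) F i ->
  #|X| <= #|[set i | P i]|.
Proof.
move=> F1 /subset_leq_card /leq_trans; apply.
rewrite -sum1dep_card; apply: (big_ind2 (fun (S : {set E}) m => #|S| <= m)) => //.
- by rewrite cards0.
- by move=> S m S' m' h h'; rewrite (leq_trans (leq_card_setU _ _)) ?leq_add.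
Qed.

(** The matrix type in [positroid] mentions [rank M] and [#|E|]; with variables [r] and [m] the
    equations are substituted and no cast arises. *)
Lemma positroid_of_matrix (R : realType) (E : finType) (M : matroid E) r m
    (A : 'M[R]_(r, m)) (pos : E -> 'I_m) :
    rank M = r -> #|E| = m -> bijective pos -> represents A pos M ->
    (forall f : 'I_r -> 'I_m, {homo f : i j / (i < j)%N} -> (0 <= \det (colsub f A))%R) ->
  positroid R M.
Proof. by move=> er em; subst r m => bp rp nn; exists A, pos. Qed.

(** * Positroid and transversal presentations *)

Section IntervalMatroid.
Variables (n c : nat).
Hypotheses (n0 : 0 < n) (cn : c <= n).

Lemma interval_matroid_positroid (R : realType) : positroid R (interval_matroid cn).
Proof.
have [x hx] := exists_window_weights cn R.
apply: (@positroid_of_matrix _ _ _ _ _ (window_mx n c x) id).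
- exact: interval_matroid_rank.
- exact: card_ord.
- by exists id.
- exact: window_mx_represents.
- by move=> f; apply: det_window_mx_ge0.
Qed.

Lemma interval_matroid_transversal :
  transversal_matroid (interval_matroid cn).
Proof.
(* Positive minors over the rationals take the place of Hall's condition: each matches a basis with
   the rows. *)
have [x hx] := exists_window_weights cn rat.
pose W (i : 'I_(3 * n)) := [set q : 'I_(6 * n) | window n c i q].
exists (3 * n), (fun i => rank_one_matroid (W i)); split.
  move=> i; apply: rank_one_rank; apply/set0Pn.
  (* Column 0 meets the rows of P and S, column 3n those of Q. *)
  have q0 : 0 < 6 * n by lia.
  have q3 : 3 * n < 6 * n by lia.
  have := ltn_ord i; have [i2|i2] := ltnP i (2 * n) => i3.
    by exists (Ordinal q0); rewrite inE /window /=; lia.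
  by exists (Ordinal q3); rewrite inE /window /=; lia.
move=> X; split=> [iX|[I iI XI]].
  have [g Xg dg] := indep_window_mx n0 hx iX.
  have [s hs] := @window_mx_matching _ _ _ _ _ id g dg.
  exists (fun i => X :&: [set g (s i)]).
    move=> i; rewrite rank_one_indep; apply/andP; split.
      by have := subset_leq_card (subsetIr X [set g (s i)]); rewrite cards1.
    by apply/subsetP => q; rewrite !inE => /andP[_ /eqP->]; apply: hs.
  apply/setP => q; apply/idP/bigcupP => [qX|[i _]]; last by rewrite inE => /andP[].
  have /imsetP[p _ qE] := subsetP Xg q qX.
  by exists ((s^-1)%g p) => //; rewrite !inE qX permKV qE eqxx.
have I1 i : #|I i| <= 1 by have := iI i; rewrite rank_one_indep => /andP[].
have IW i q : q \in I i -> window n c i q.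
  by have := iI i; rewrite rank_one_indep => /andP[_ /subsetP h] /h; rewrite inE.
have count (Y : {set 'I_(6 * n)}) (P : pred 'I_(3 * n)) :
    (forall (i : 'I_(3 * n)) q, q \in Y -> window n c i q -> P i) -> #|X :&: Y| <= #|[set i | P i]|.
  move=> YP; apply: (card_le_bigcup_small I1); apply/subsetP => q.
  rewrite inE XI => /andP[/bigcupP[i _ qi] qY].
  by apply/bigcupP; exists i => //; apply: (YP i q qY); apply: IW.
rewrite interval_matroid_indepE //; apply/and3P; split.
- have := count setT predT (fun _ _ _ _ => isT); rewrite setIT => /leq_trans; apply.
  by rewrite (leq_trans (max_card _)) // card_ord.
- have b2 : 2 * n <= 3 * n by lia.
  rewrite -[leqRHS](card_ord_lt b2); apply: count => i q; rewrite inE /window; lia.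
- have -> : 2 * n = 3 * n - n by lia.
  rewrite -(card_ord_interval n (leqnn (3 * n))); apply: count => i q.
  by rewrite ltn_ord inE /window; lia.
Qed.

End IntervalMatroid.

Theorem theorem5p2 (R : realType) (n : nat) (hn : 0 < n) :
  exists (E1 E2 : finType) (M' : matroid E1) (N' : matroid E2),
    coloopless M' /\ coloopless N' /\
    self_dual M' /\ self_dual N' /\
    positroid R M' /\ positroid R N' /\
    transversal_matroid M' /\ transversal_matroid N' /\
    same_configuration M' N' /\
    kappa M' + n <= kappa N'.
Proof.
have cE : #|'I_(6 * n)| = 6 * n by rewrite card_ord.
have cA := card_flatA n.
have cB0 := card_flatB (leq0n n); have cBn := card_flatB (leqnn n).
exists 'I_(6 * n), 'I_(6 * n).
exists (interval_matroid (leq0n n)), (interval_matroid (leqnn n)).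
do ![split].
- exact: two_flat_coloopless.
- exact: two_flat_coloopless.
- exact: interval_matroid_self_dual.
- exact: interval_matroid_self_dual.
- exact: interval_matroid_positroid.
- exact: interval_matroid_positroid.
- exact: interval_matroid_transversal.
- exact: interval_matroid_transversal.
- exact: two_flat_same_configuration.
have AB0 : flatA n :&: flatB n 0 = set0.
  by apply: cards0_eq; rewrite card_flatAB.
(* The vertical connectivity is at most n + 1 for c = 0 and exceeds 2n for c = n. *)
have := two_flat_kappa_le (card_flatAB_le (leq0n n)) hn cE cA cB0 AB0.
have := two_flat_kappa_gt (card_flatAB_le (leqnn n)) hn cE cA cBn.
rewrite card_flatAB // /interval_matroid; lia.
Qed.
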